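(* Let $\mathfrak{D}\subset\mathbb{R}^{m\times d}$ and let $g$ be a penalty. Assume one of the following: (I) $g$ satisfies A1–A4, or $(g,\mathfrak{D})$ satisfy B1–B4; or (II) $(g,\mathfrak{D})$ satisfy B1–B3. Set $D_0=1$ in case (I) and $D_0=\max(1/\kappa,1)$ in case (II) (with $\kappa$ from B2). Let $\mathbb{P}$ be a distribution on $\mathbb{R}^m$ satisfying C1 and C2 with constants $c>0$, $T\in(0,+\infty]$. Assume there are constants $C\ge1$, $h\ge1$ such that $\mathcal{N}(\mathfrak{D},\epsilon)\le (C/\epsilon)^h$ for all $0<\epsilon\le1$. Let $L>L_{\mathbb{P}}(\bar g)$ and define $\beta\triangleq h\cdot\max\big(\log\tfrac{2LC}{c},1\big)$. Assume the sample size $n$ satisfies $$\frac{n}{\log n}\ \ge\ \max\Big(8,\ \frac{\beta}{T^2},\ D_0\Big(\frac{c}{2L}\Big)^2\beta\Big)$$ (with $\beta/T^2=0$ if $T=\infty$). Then for every $x$ with $0\le x\le nT^2-\beta\log n$, if $x_1,\dots,x_n$ are drawn i.i.d. from $\mathbb{P}$ and $X=[x_1,\dots,x_n]$, we have, except with probability at most $\Lambda_n(L)+2e^{-x}$, $$\sup_{D\in\mathfrak{D}}\big|F_X(D)-\mathbb{E}_{x\sim\mathbb{P}}f_x(D)\big|\le \eta_n,$$ where $\eta_n=2c\sqrt{\frac{\beta\log n}{n}}+c\sqrt{\frac{\beta+x}{n}}$ in case (I) and $\eta_n=3c\sqrt{\frac{\beta\log n}{n}}+c\sqrt{\frac{\beta+x}{n}}$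 in case (II).
   Context: Let $m,d,n\ge1$. A penalty is a function $g:\mathbb{R}^d\to\mathbb{R}\cup\{+\infty\}$, not identically $+\infty$. For $x\in\mathbb{R}^m$, $D\in\mathbb{R}^{m\times d}$, $\alpha\in\mathbb{R}^d$ let $\mathcal{L}_x(D,\alpha)=\tfrac12\|x-D\alpha\|_2^2+g(\alpha)$ and $f_x(D)=\inf_{\alpha\in\mathbb{R}^d}\mathcal{L}_x(D,\alpha)$. For $X=[x_1,\dots,x_n]\in\mathbb{R}^{m\times n}$ let $F_X(D)=\frac1n\sum_{i=1}^n f_{x_i}(D)$. For $\Delta=[\delta_1,\dots,\delta_d]\in\mathbb{R}^{m\times d}$, $\|\Delta\|_{1\to2}=\sup_{\|\alpha\|_1\le1}\|\Delta\alpha\|_2=\max_j\|\delta_j\|_2$. Assumptions on $g$: A1: $g\ge0$; A2: $g$ is lower semi-continuous; A3: $g$ is coercive, i.e. $g(\alpha)\to+\infty$ as $\|\alpha\|\to\infty$; A4: $g(0)=0$. Joint assumptions on $g$ and a set $\mathfrak{D}\subset\mathbb{R}^{m\times d}$: B1: $g=\chi_{\mathcal K}$ is the indicator of a set $\mathcal K\subset\mathbb{R}^d$ ($0$ on $\mathcal K$, $+\infty$ outside); B2: there is $\kappa>0$ with $\kappa\|\alpha\|_1^2\le\|D\alpha\|_2^2$ for all $\alpha\in\mathcal K$, $D\in\mathfrak{D}$; B3: $0\in\mathcal K$; B4: $\mathfrak{D}$ is convex. The function $\bar g:[0,\infty)\to[0,\infty)$: under A1–A3, $\bar g(t)=\sup\{\|\alpha\|_1:\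 g(\alpha)\le t\}$ (with $\sup\emptyset=0$); under B1–B3, $\bar g(t)=2\sqrt{2t/\kappa}$. For $X=[x_1,\dots,x_n]$, $L_X(\bar g)=\frac1n\sum_{i=1}^n\|x_i\|_2\,\bar g(\|x_i\|_2^2/2)$. Probabilistic notions: $\mathbb{P}$ is a probability distribution on $\mathbb{R}^m$ and $x_1,\dots,x_n$ are i.i.d. with law $\mathbb{P}$, $X=[x_1,\dots,x_n]$. $L_{\mathbb{P}}(\bar g)=\mathbb{E}_{x\sim\mathbb{P}}\|x\|_2\bar g(\|x\|_2^2/2)$. $\Lambda_n(L)=\mathbb{P}(L_X(\bar g)>L)$. $\Gamma_n(\gamma)=\sup_{D\in\mathfrak{D}}\mathbb{P}\big(|F_X(D)-\mathbb{E}f_x(D)|>\gamma\big)$. C1: $L_{\mathbb{P}}(\bar g)<+\infty$. C2: there are $c>0$ and $T\in(0,+\infty]$ such that $\Gamma_n(c\tau)\le2\exp(-n\tau^2)$ for all $0\le\tau\le T$ and all $n$. Covering number: $\mathcal{N}(\mathfrak{D},\epsilon)$ is the minimal cardinality of a set $\mathfrak{Q}\subset\mathfrak{D}$ such that every $D\in\mathfrak{D}$ satisfies $\|D-q\|_{1\to2}\le\epsilon$ for some $q\in\mathfrak{Q}$. *)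

(* Defs.v *)
From HB Require Import structures.
From mathcomp Require Import all_boot all_order all_algebra.
From mathcomp Require Import all_classical all_reals all_analysis.
Set Implicit Arguments. Unset Strict Implicit. Unset Printing Implicit Defensive.
Import Order.TTheory GRing.Theory Num.Theory.
Import numFieldNormedType.Exports.
Local Open Scope classical_set_scope.
Local Open Scope ring_scope.

Section Defs.
Variable R : realType.

Definition Rvec (k : nat) := g_sigma_algebraType (@open 'cV[R]_k).

Definition norm2 {k : nat} (v : 'cV[R]_k) : R := Num.sqrt (\sum_(i < k) (v i 0) ^+ 2).
Definition norm1 {k : nat} (v : 'cV[R]_k) : R := \sum_(i < k) `|v i 0|.

Definition opnorm12 {m d : nat} (Dl : 'M[R]_(m, d)) : R :=
  \big[Num.max/0]_(j < d) norm2 (col j Dl).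

Section WithDims.
Variables m d : nat.

Definition is_penalty (g : 'cV[R]_d -> \bar R) : Prop :=
  (forall a, g a <> -oo%E) /\ (exists a, g a <> +oo%E).

Definition Lx (g : 'cV[R]_d -> \bar R) (x : 'cV[R]_m) (D : 'M[R]_(m, d))
  (a : 'cV[R]_d) : \bar R :=
  ((2^-1 * norm2 (x - D *m a) ^+ 2)%:E + g a)%E.
Definition floss (g : 'cV[R]_d -> \bar R) (x : 'cV[R]_m) (D : 'M[R]_(m, d)) : \bar R :=
  ereal_inf [set Lx g x D a | a in [set: 'cV[R]_d]].

Definition Femp (g : 'cV[R]_d -> \bar R) (n : nat) (X : 'I_n -> 'cV[R]_m)
  (D : 'M[R]_(m, d)) : \bar R :=
  ((n%:R)^-1%:E * \sum_(i < n) floss g (X i) D)%E.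

Definition Ef (g : 'cV[R]_d -> \bar R) (P : probability (Rvec m) R)
  (D : 'M[R]_(m, d)) : \bar R :=
  (\int[P]_x floss g x D)%E.

Definition A1 (g : 'cV[R]_d -> \bar R) := forall a, (0 <= g a)%E.
Definition A2 (g : 'cV[R]_d -> \bar R) :=
  forall (a : 'cV[R]_d) (t : R), (t%:E < g a)%E ->
    exists e : R, 0 < e /\ forall b, norm2 (b - a) < e -> (t%:E < g b)%E.
Definition A3 (g : 'cV[R]_d -> \bar R) :=
  forall M : R, exists r : R, forall a, r <= norm2 a -> (M%:E <= g a)%E.
Definition A4 (g : 'cV[R]_d -> \bar R) := g 0 = 0%E.

Definition B1 (g : 'cV[R]_d -> \bar R) (K : set 'cV[R]_d) :=
  forall a, (K a -> g a = 0%E) /\ (~ K a -> g a = +oo%E).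
Definition B2 (K : set 'cV[R]_d) (Dset : set 'M[R]_(m, d)) (kappa : R) :=
  0 < kappa /\
  forall a D, K a -> Dset D -> kappa * (norm1 a) ^+ 2 <= norm2 (D *m a) ^+ 2.
Definition B3 (K : set 'cV[R]_d) := K 0.
Definition B4 (Dset : set 'M[R]_(m, d)) :=
  forall D1 D2 (t : R), Dset D1 -> Dset D2 -> 0 <= t <= 1 ->
    Dset (t *: D1 + (1 - t) *: D2).

Definition B123 g Dset kappa :=
  exists K : set 'cV[R]_d, B1 g K /\ B2 K Dset kappa /\ B3 K.

Definition gbarA (g : 'cV[R]_d -> \bar R) (t : R) : R :=
  sup [set norm1 a | a in [set a | (g a <= t%:E)%E]].   (* sup set0 = 0 *)
Definition gbarB (kappa : R) (t : R) : R := 2 * Num.sqrt (2 * t / kappa).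

(* The three settings of the theorem, together with the associated gbar,
   D0 and the constant k in front of c sqrt(beta log n / n):
   (I)  A1-A4 (gbar from A1-A3), or B1-B4 (gbar from B1-B3): D0 = 1, k = 2;
   (II) B1-B3: D0 = max(1/kappa,1), k = 3. *)
Definition setting (g : 'cV[R]_d -> \bar R) (Dset : set 'M[R]_(m, d))
  (gbar : R -> R) (D0 k : R) : Prop :=
  [/\ A1 g, A2 g, A3 g, A4 g & [/\ gbar = gbarA g, D0 = 1 & k = 2]]
  \/ (exists kappa, [/\ B123 g Dset kappa, B4 Dset &
                        [/\ gbar = gbarB kappa, D0 = 1 & k = 2]])
  \/ (exists kappa, B123 g Dset kappa /\
                        [/\ gbar = gbarB kappa, D0 = Num.max (kappa^-1) 1 & k = 3]).

Definition LX (gbar : R -> R) (n : nat) (X : 'I_n -> 'cV[R]_m) : R :=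
  (n%:R)^-1 * \sum_(i < n) norm2 (X i) * gbar (norm2 (X i) ^+ 2 / 2).
Definition LP (gbar : R -> R) (P : probability (Rvec m) R) : \bar R :=
  (\int[P]_x (norm2 x * gbar (norm2 x ^+ 2 / 2))%:E)%E.

Definition iid_sample {dO} {Omega : measurableType dO} (Pr : probability Omega R)
  (P : probability (Rvec m) R) (n : nat) (xs : 'I_n -> Omega -> Rvec m) : Prop :=
  [/\ (forall i, measurable_fun setT (xs i)),
      (forall A : 'I_n -> set (Rvec m), (forall i, measurable (A i)) ->
         Pr (\bigcap_(i in [set: 'I_n]) (xs i @^-1` A i))
         = (\prod_(i < n) Pr (xs i @^-1` A i))%E) &
      (forall i (A : set (Rvec m)), measurable A -> Pr (xs i @^-1` A) = P A)].

Definition Lambda {dO} {Omega : measurableType dO} (Pr : probability Omega R)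
  (gbar : R -> R) (n : nat) (xs : 'I_n -> Omega -> Rvec m) (L : R) : \bar R :=
  Pr [set w | L < LX gbar (fun i => xs i w)].

Definition Gamma {dO} {Omega : measurableType dO} (Pr : probability Omega R)
  (g : 'cV[R]_d -> \bar R) (Dset : set 'M[R]_(m, d)) (P : probability (Rvec m) R)
  (n : nat) (xs : 'I_n -> Omega -> Rvec m) (gamma : R) : \bar R :=
  ereal_sup [set Pr [set w | (gamma%:E < `| Femp g (fun i => xs i w) D - Ef g P D |)%E]
            | D in Dset].

Definition C1 (gbar : R -> R) (P : probability (Rvec m) R) : Prop :=
  (LP gbar P < +oo)%E.
(* Gamma_n only depends on the law P of the sample; we require the bound for
   every realization of an i.i.d. n-sample of law P, for every n >= 1. *)
Definition C2 (g : 'cV[R]_d -> \bar R) (Dset : set 'M[R]_(m, d))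
  (P : probability (Rvec m) R) (c : R) (T : \bar R) : Prop :=
  [/\ 0 < c, (0 < T)%E &
   forall (n : nat) (dO : measure_display) (Omega : measurableType dO)
     (Pr : probability Omega R) (xs : 'I_n -> Omega -> Rvec m),
     (0 < n)%N -> iid_sample Pr P xs ->
     forall tau : R, 0 <= tau -> (tau%:E <= T)%E ->
       (Gamma Pr g Dset P xs (c * tau) <= (2 * expR (- (n%:R * tau ^+ 2)))%:E)%E].

(* covering number N(Dset, eps) w.r.t. ||.||_{1->2}, with values in \bar R
   (+oo if no finite cover exists) *)
Definition is_eps_cover (Dset : set 'M[R]_(m, d)) (eps : R) (Q : seq 'M[R]_(m, d)) :=
  (forall q, q \in Q -> Dset q) /\
  (forall D, Dset D -> exists2 q, q \in Q & opnorm12 (D - q) <= eps).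
Definition covering_number (Dset : set 'M[R]_(m, d)) (eps : R) : \bar R :=
  ereal_inf [set ((size Q)%:R)%:E | Q in [set Q | uniq Q /\ is_eps_cover Dset eps Q]].

End WithDims.

Definition beta_over_T2 (beta : R) (T : \bar R) : R :=
  match T with EFin t => beta / t ^+ 2 | _ => 0 end.

End Defs.

(* Main.v *)
(* Cover [Dset] by an [eps]-net with [eps = c / (2 L) * sqrt (beta ln n / n)];
   it has at most [n^beta] points.  C2 with [n tau^2 = beta ln n + x] and a union
   bound control the deviation at every point of the net, up to probability
   [2 exp (- x)].  Away from the net, [F_X] and [E f] are Lipschitz with constants
   [(k - 1) LX] and [(k - 1) LP], both at most [(k - 1) L] off the event [LX > L].

   The Lipschitz bound comes from testing [f_x D'] with near-minimisers for
   [f_x D], which costs a linear term plus a quadratic one in the distance from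
   [D] to [D'].  On a convex set the quadratic term disappears by subdividing the
   segment; without convexity it is at most the linear term once
   [eps ^+ 2 <= kappa]. *)
Require Import Defs.
From HB Require Import structures.
From mathcomp Require Import all_boot all_order all_algebra.
From mathcomp Require Import all_classical all_reals all_analysis.
From mathcomp Require Import measurable_realfun ring lra.
Set Implicit Arguments. Unset Strict Implicit. Unset Printing Implicit Defensive.
Import Order.TTheory GRing.Theory Num.Theory.
Import numFieldNormedType.Exports.
Local Open Scope classical_set_scope.
Local Open Scope ring_scope.

(** * Euclidean, [l^1] and column norms *)

Section Norms.
Context {R : realType}.

Lemma sum_CauchySchwarz (I : finType) (a b : I -> R) :
  (\sum_i a i * b i) ^+ 2 <= (\sum_i a i ^+ 2) * (\sum_i b i ^+ 2).
Proof.
set S := \sum_i a i * b i; set A := \sum_i a i ^+ 2; set B := \sum_i b i ^+ 2.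
have A0 : 0 <= A by apply: sumr_ge0 => i _; exact: sqr_ge0.
(* This sum of squares expands to [A * (A * B - S ^+ 2)]. Dividing by [A] gives the claim; if [A]
   vanishes, so does every [a i]. *)
have : 0 <= \sum_i (A * b i - S * a i) ^+ 2.
  by apply: sumr_ge0 => i _; exact: sqr_ge0.
have -> : \sum_i (A * b i - S * a i) ^+ 2 = A * (A * B - S ^+ 2).
  transitivity (\sum_i (A ^+ 2 * b i ^+ 2 - 2 * A * S * (a i * b i)
                        + S ^+ 2 * a i ^+ 2)).
    by apply: eq_bigr => i _; ring.
  by rewrite big_split sumrB /= -!mulr_sumr -/A -/B -/S; ring.
have [/eqP A_eq0 _|A_neq0] := boolP (A == 0).
  have a0 i : a i = 0.
    move/eqP: A_eq0; rewrite /A psumr_eq0 => [/allP/(_ i)|j _]; last exact: sqr_ge0.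
    by rewrite mem_index_enum /= => /(_ isT); rewrite sqrf_eq0 => /eqP.
  by rewrite /S big1 ?expr0n ?A_eq0 ?mul0r // => i _; rewrite a0 mul0r.
by rewrite pmulr_rge0 ?lt0r ?A_neq0 // subr_ge0.
Qed.

Lemma norm2_ge0 {k} (v : 'cV[R]_k) : 0 <= norm2 v.
Proof. exact: sqrtr_ge0. Qed.

Lemma norm2_sqr {k} (v : 'cV[R]_k) : norm2 v ^+ 2 = \sum_i v i 0 ^+ 2.
Proof. by rewrite sqr_sqrtr // sumr_ge0 // => i _; exact: sqr_ge0. Qed.

Lemma norm2_0 {k} : norm2 (0 : 'cV[R]_k) = 0.
Proof. by rewrite /norm2 big1 ?sqrtr0 // => i _; rewrite mxE expr0n. Qed.

Lemma norm2Z {k} (t : R) (v : 'cV[R]_k) : norm2 (t *: v) = `|t| * norm2 v.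
Proof.
rewrite /norm2 (eq_bigr (fun i => t ^+ 2 * v i 0 ^+ 2)); last first.
  by move=> i _; rewrite mxE exprMn.
by rewrite -mulr_sumr sqrtrM ?sqr_ge0 // sqrtr_sqr.
Qed.

Lemma norm2N {k} (v : 'cV[R]_k) : norm2 (- v) = norm2 v.
Proof. by rewrite -scaleN1r norm2Z normrN1 mul1r. Qed.

Lemma ler_norm2D {k} (u v : 'cV[R]_k) : norm2 (u + v) <= norm2 u + norm2 v.
Proof.
rewrite -ler_sqr ?nnegrE ?addr_ge0 ?norm2_ge0 // sqrrD !norm2_sqr.
rewrite (eq_bigr (fun i => u i 0 ^+ 2 + u i 0 * v i 0 *+ 2 + v i 0 ^+ 2)); last first.
  by move=> i _; rewrite mxE sqrrD.
rewrite !big_split /= lerD2r lerD2l -mulr2n lerMn2r /=.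
apply: le_trans (ler_norm _) _.
rewrite -ler_sqr ?nnegrE ?mulr_ge0 ?norm2_ge0 // real_normK ?num_real //.
by rewrite exprMn !norm2_sqr; exact: sum_CauchySchwarz.
Qed.

Lemma norm1_ge0 {k} (v : 'cV[R]_k) : 0 <= norm1 v.
Proof. by apply: sumr_ge0. Qed.

(** Each coordinate is at most [norm2 v] in absolute value. The factor [k], rather than its square
    root, is enough to bound sublevel sets. *)
Lemma norm1_le_norm2 {k} (v : 'cV[R]_k) : norm1 v <= k%:R * norm2 v.
Proof.
rewrite -[k in k%:R]card_ord mulr_natl -sumr_const; apply: ler_sum => i _.
rewrite -[`|v i 0|]sqrtr_sqr ler_sqrt; last first.
  by rewrite sumr_ge0 // => j _; exact: sqr_ge0.
by rewrite (bigD1 i) //= lerDl sumr_ge0 // => j _; exact: sqr_ge0.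
Qed.

Lemma opnorm12_ge0 {m d} (A : 'M[R]_(m, d)) : 0 <= opnorm12 A.
Proof. exact: bigmax_ge_id. Qed.

Lemma opnorm12_leP {m d} (A : 'M[R]_(m, d)) (e : R) : 0 <= e ->
  reflect (forall j, norm2 (col j A) <= e) (opnorm12 A <= e).
Proof.
move=> e0; apply: (iffP (@bigmax_leP _ _ _ 0 e predT _)) => [[_ H] j|H]; first exact: H.
by split.
Qed.

Lemma opnorm12Z {m d} (t : R) (A : 'M[R]_(m, d)) :
  opnorm12 (t *: A) <= `|t| * opnorm12 A.
Proof.
have t0 := normr_ge0 t.
apply/opnorm12_leP => [|j]; first by rewrite mulr_ge0 ?opnorm12_ge0.
rewrite linearZ /= norm2Z ler_wpM2l //; move: j.
exact/opnorm12_leP/lexx/opnorm12_ge0.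
Qed.

Lemma opnorm12N {m d} (A : 'M[R]_(m, d)) : opnorm12 (- A) = opnorm12 A.
Proof.
by apply: eq_bigr => j _; rewrite linearN norm2N.
Qed.

(** The vector [A *m a] is the combination of the columns of [A] with coefficients [a j 0], so the
    triangle inequality applies. *)
Lemma norm2_mulmx {m d} (A : 'M[R]_(m, d)) (a : 'cV[R]_d) :
  norm2 (A *m a) <= opnorm12 A * norm1 a.
Proof.
have -> : A *m a = \sum_j a j 0 *: col j A.
  by apply/colP => i; rewrite mxE summxE; apply: eq_bigr => j _; rewrite !mxE mulrC.
apply: (@le_trans _ _ (\sum_j norm2 (a j 0 *: col j A))).
  elim/big_rec2 : _ => [|j y v _ IH]; first by rewrite norm2_0.
  by apply: le_trans (ler_norm2D _ _) _; rewrite lerD2l.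
rewrite /norm1 mulr_sumr; apply: ler_sum => j _; rewrite norm2Z mulrC.
by rewrite ler_wpM2r //; move: j; exact/opnorm12_leP/lexx/opnorm12_ge0.
Qed.

End Norms.

(** * Perturbation of the loss in the dictionary *)

Section Loss.
Context {R : realType} {m d : nat}.
Implicit Types (g : 'cV[R]_d -> \bar R) (x : 'cV[R]_m) (D : 'M[R]_(m, d)).

Lemma floss_ge0 g x D : A1 g -> (0 <= floss g x D)%E.
Proof.
move=> g0; apply/ereal_infP => _ [a _ <-].
by rewrite adde_ge0 // lee_fin mulr_ge0 // sqr_ge0.
Qed.

Lemma floss_le g x D : A4 g -> (floss g x D <= (norm2 x ^+ 2 / 2)%:E)%E.
Proof.
move=> g0; apply: ge_ereal_inf; exists (Lx g x D 0); first by exists 0.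
by rewrite /Lx g0 adde0 mulmx0 subr0 mulrC.
Qed.

Lemma floss_fin_num g x D : A1 g -> A4 g -> floss g x D \is a fin_num.
Proof.
move=> g1 g4; rewrite ge0_fin_numE ?floss_ge0 //.
by rewrite (le_lt_trans (floss_le x D g4)) ?ltry.
Qed.

(* Only near-minimisers [a], those doing better than [a = 0], need to be bounded. *)
Lemma floss_perturb g x D D' (G : R) : A1 g -> A4 g -> 0 <= G ->
  (forall a, (g a <= (norm2 x ^+ 2 / 2)%:E)%E -> norm2 (x - D *m a) <= norm2 x ->
     norm1 a <= G) ->
  (floss g x D' <= floss g x D + (norm2 x * G * opnorm12 (D' - D)
                     + 2^-1 * G ^+ 2 * opnorm12 (D' - D) ^+ 2)%:E)%E.
Proof.
move=> g1 g4 G0 aG; set e := opnorm12 _.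
have e0 : 0 <= e := opnorm12_ge0 _.
have x0 := norm2_ge0 x.
set w : R := _ + _.
have w0 : 0 <= w by rewrite addr_ge0 // !mulr_ge0 // sqr_ge0.
rewrite -leeBlDr //; apply/ereal_infP => _ [a _ <-]; rewrite leeBlDr //.
(* A competitor [a] no better than zero needs no estimate: testing with zero already bounds the loss
   at [D'] by [norm2 x ^+ 2 / 2]. *)
have [large|small] := leP (norm2 x ^+ 2 / 2)%:E (Lx g x D a).
  apply: le_trans (floss_le _ _ g4) _; apply: le_trans large _.
  by rewrite leeDl // lee_fin.
have u0 := norm2_ge0 (x - D *m a).
have ga : (g a <= (norm2 x ^+ 2 / 2)%:E)%E.
  by rewrite (le_trans _ (ltW small)) // leeDr // lee_fin mulr_ge0 // sqr_ge0.
have ux : norm2 (x - D *m a) <= norm2 x.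
  rewrite -ler_sqr // -(ler_pM2l (_ : 0 < 2^-1)) ?invr_gt0 // [leRHS]mulrC.
  by rewrite -lee_fin (le_trans _ (ltW small)) // leeDl.
have aG1 := aG _ ga ux.
apply: (@le_trans _ _ (Lx g x D' a)).
  by apply: ge_ereal_inf; exists (Lx g x D' a) => //; exists a.
rewrite /Lx addeAC -EFinD leeD2r // lee_fin.
have v0 : 0 <= norm2 ((D - D') *m a) by exact: norm2_ge0.
have veG : norm2 ((D - D') *m a) <= G * e.
  rewrite -opprB mulNmx norm2N mulrC.
  exact: le_trans (norm2_mulmx _ _) (ler_wpM2l e0 aG1).
have : norm2 (x - D' *m a) <= norm2 (x - D *m a) + norm2 ((D - D') *m a).
  apply: le_trans (ler_norm2D _ _); rewrite mulmxBl addrA subrK //.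
have := norm2_ge0 (x - D' *m a).
rewrite /w; move: (norm2 (x - D' *m a)) (norm2 (x - D *m a)) u0 ux
  (norm2 ((D - D') *m a)) v0 veG => r u u0 ux v v0 veG r0 ruv.
(* Halving [(u + v) ^+ 2], the cross term [u * v] gives the linear part of [w] and [v ^+ 2 / 2] the
   quadratic part. *)
have : r ^+ 2 <= (u + v) ^+ 2 by rewrite ler_sqr ?nnegrE ?addr_ge0.
have : u * v <= norm2 x * (G * e) by rewrite ler_pM.
have : v ^+ 2 <= (G * e) ^+ 2 by rewrite ler_sqr ?nnegrE // mulr_ge0.
nra.
Qed.

(* Halving the segment halves the total quadratic error, which therefore vanishes. *)
Lemma convex_linearize (S : set 'M[R]_(m, d)) (u : 'M[R]_(m, d) -> R) (a b : R) :
  B4 S -> 0 <= a -> 0 <= b ->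
  (forall D D', S D -> S D' ->
     u D' <= u D + (a * opnorm12 (D' - D) + b * opnorm12 (D' - D) ^+ 2)) ->
  forall D D', S D -> S D' -> u D' <= u D + a * opnorm12 (D' - D).
Proof.
move=> Sconv a0 b0 uP.
have halving N D D' : S D -> S D' ->
    u D' <= u D + (a * opnorm12 (D' - D) + b / 2 ^+ N * opnorm12 (D' - D) ^+ 2).
  elim: N D D' => [|N IH] D D' SD SD'; first by rewrite expr0 divr1; exact: uP.
  (* Passing through the midpoint makes two steps of half the length: the linear errors add up to
     the original one, the quadratic ones to half of it. *)
  pose M := 2^-1 *: D + (1 - 2^-1) *: D'.
  have SM : S M by apply: Sconv => //; lra.
  have D'M : D' - M = 2^-1 *: (D' - D).
    by apply/matrixP => i j; rewrite !mxE; field.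
  have MD : M - D = 2^-1 *: (D' - D).
    by apply/matrixP => i j; rewrite !mxE; field.
  have := opnorm12Z 2^-1 (D' - D); rewrite ger0_norm ?invr_ge0 //.
  have := IH _ _ SD SM; have := IH _ _ SM SD'; rewrite D'M MD.
  have := opnorm12_ge0 (2^-1 *: (D' - D)); have := opnorm12_ge0 (D' - D).
  have -> : b / 2 ^+ N.+1 = b / 2 ^+ N / 2 by rewrite exprSr invfM mulrA.
  have := divr_ge0 b0 (exprn_ge0 N (ler0n R 2)).
  move: (opnorm12 (2^-1 *: _)) (opnorm12 _) (b / _) => e' e q q0 e0 e'0 H1 H2 ee'.
  have ae : a * e' <= a * (2^-1 * e) by rewrite ler_wpM2l.
  have qe : q * e' ^+ 2 <= q * (2^-1 * e) ^+ 2.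
    by rewrite ler_wpM2l // ler_sqr ?nnegrE // mulr_ge0.
  lra.
move=> D D' SD SD'; apply/ler_addgt0Pr => eps eps0.
set q := b * opnorm12 (D' - D) ^+ 2.
have q0 : 0 <= q by rewrite mulr_ge0 // sqr_ge0.
(* Since [2 ^ N > N > q / eps], the remaining quadratic error [q / 2 ^ N] is below [eps]. *)
pose N := Num.bound (q / eps).
apply: le_trans (halving N _ _ SD SD') _; rewrite addrA lerD2l.
rewrite mulrAC -/q ler_pdivrMr ?exprn_gt0 // mulrC -ler_pdivrMr //.
have : q / eps < N%:R by rewrite archi_boundP // divr_ge0 // ltW.
move/ltW/le_trans; apply; rewrite -natrX ler_nat.
by rewrite ltnW // ltn_expl.
Qed.

End Loss.

(** * Bounds and monotonicity of the two versions of [gbar] *)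

Section Gbar.
Context {R : realType} {d : nat}.
Implicit Type g : 'cV[R]_d -> \bar R.

(** Beyond the radius where coercivity gives [g a >= t + 1], no point has [g a <= t]. The bound
    ensures that [sup] in [gbarA] is a true supremum of a nonempty sublevel set and not a default
    value. *)
Lemma has_ubound_sublevel g t : A3 g ->
  has_ubound [set norm1 a | a in [set a | (g a <= t%:E)%E]].
Proof.
move=> /(_ (t + 1)) [r gr]; exists (d%:R * `|r|) => _ [a /= gat <-].
apply: le_trans (norm1_le_norm2 a) _; rewrite ler_wpM2l // ltW //.
apply: lt_le_trans (ler_norm r); rewrite ltNge; apply/negP => /gr.
by move/le_trans => /(_ _ gat); rewrite lee_fin gerDl ler10.
Qed.

Lemma norm1_le_gbarA g t a : A3 g -> (g a <= t%:E)%E -> norm1 a <= gbarA g t.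
Proof. by move=> g3 gat; apply: ub_le_sup; [exact: has_ubound_sublevel|exists a]. Qed.

Lemma gbarA_ge0 g t : A3 g -> 0 <= gbarA g t.
Proof.
move=> g3; have [[a gat]|none] := pselect (exists a, (g a <= t%:E)%E).
  exact: le_trans (norm1_ge0 a) (norm1_le_gbarA g3 gat).
rewrite /gbarA (_ : [set _ | _ in _] = set0) ?sup0 //.
by rewrite -subset0 => r [a gat _]; apply: none; exists a.
Qed.

(** Monotone functions are Borel; this is how the integrand of [LP] is shown to be measurable. *)
Lemma gbarA_nondecreasing g : A3 g -> {homo gbarA g : s t / s <= t}.
Proof.
move=> g3 s t st; have [[a gas]|none] := pselect (exists a, (g a <= s%:E)%E).
  apply: ge_sup => [|_ [b /= gbs <-]]; first by exists (norm1 a), a.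
  by apply: norm1_le_gbarA => //; apply: le_trans gbs _; rewrite lee_fin.
rewrite {1}/gbarA (_ : [set _ | _ in _] = set0) ?sup0 ?gbarA_ge0 //.
by rewrite -subset0 => r [a gat _]; apply: none; exists a.
Qed.

Lemma gbarB_ge0 (kappa t : R) : 0 <= gbarB kappa t.
Proof. by rewrite mulr_ge0 // sqrtr_ge0. Qed.

Lemma gbarB_nondecreasing (kappa : R) : 0 < kappa ->
  {homo gbarB kappa : s t / s <= t}.
Proof.
move=> kappa0 s t st; rewrite ler_pM2l // ler_wsqrtr //.
by rewrite ler_pM2r ?invr_gt0 // ler_pM2l.
Qed.

Lemma gbarB_half_sqr (kappa r : R) : 0 < kappa ->
  gbarB kappa (r ^+ 2 / 2) ^+ 2 = (2 * r) ^+ 2 / kappa.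
Proof.
move=> kappa0; rewrite /gbarB exprMn sqr_sqrtr; last first.
  by apply: divr_ge0; [have := sqr_ge0 r; lra|exact: ltW].
by field; exact: lt0r_neq0.
Qed.

End Gbar.

(** * Lipschitz bounds for the loss in each setting *)

Section Setting.
Context {R : realType} {m d : nat}.
Variables (g : 'cV[R]_d -> \bar R) (Dset : set 'M[R]_(m, d)).

Lemma indicator_A1 K : B1 g K -> A1 g.
Proof.
by move=> gK a; have [Ka|nKa] := pselect (K a); [rewrite (gK a).1|rewrite (gK a).2].
Qed.

Lemma indicator_A4 K : B1 g K -> B3 K -> A4 g.
Proof. by move=> gK K0; rewrite /A4 (gK 0).1. Qed.

(** Finiteness of [g a] puts [a] in [K], and the residual bound gives
    [norm2 (D *m a) <= 2 * norm2 x]. B2 turns this into a bound on [norm1 a]. *)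
Lemma norm1_le_gbarB K kappa x D a : B1 g K -> B2 K Dset kappa -> Dset D ->
  (g a <= (norm2 x ^+ 2 / 2)%:E)%E -> norm2 (x - D *m a) <= norm2 x ->
  norm1 a <= gbarB kappa (norm2 x ^+ 2 / 2).
Proof.
move=> gK [kappa0 DK] DD ga xDa.
have Ka : K a by apply: contrapT => nKa; move: ga; rewrite (gK a).2 // leye_eq.
rewrite -ler_sqr ?nnegrE ?norm1_ge0 ?gbarB_ge0 // gbarB_half_sqr //.
rewrite ler_pdivlMr // mulrC; apply: le_trans (DK _ _ Ka DD) _.
rewrite ler_sqr ?nnegrE ?mulr_ge0 ?norm2_ge0 //.
have -> : D *m a = x - (x - D *m a) by rewrite subKr.
by apply: le_trans (ler_norm2D _ _) _; rewrite norm2N mulr_natl mulr2n lerD2l.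
Qed.

(** The convex set [S] is separate from [Dset]: under A1-A4 the bound on [a] holds for every
    dictionary, so [S] can be the whole matrix space; under B1-B4 it is [Dset]. *)
Lemma convex_floss_lipschitz (S : set 'M[R]_(m, d)) x G : A1 g -> A4 g -> B4 S ->
  0 <= G ->
  (forall D a, S D -> (g a <= (norm2 x ^+ 2 / 2)%:E)%E ->
     norm2 (x - D *m a) <= norm2 x -> norm1 a <= G) ->
  forall D D', S D -> S D' ->
  (floss g x D' <= floss g x D + (norm2 x * G * opnorm12 (D' - D))%:E)%E.
Proof.
move=> g1 g4 Sconv G0 aG D D' SD SD'.
have lossE D0 := fineK (floss_fin_num x D0 g1 g4).
rewrite -(lossE D) -(lossE D') -EFinD lee_fin.
apply: (convex_linearize (S := S) (u := fun D => fine (floss g x D))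
  (b := 2^-1 * G ^+ 2)) => //; rewrite ?mulr_ge0 ?norm2_ge0 ?sqr_ge0 //.
move=> D1 D2 SD1 SD2; rewrite -lee_fin EFinD !lossE.
by apply: floss_perturb => // a; exact: aG.
Qed.

Lemma setting_floss_lipschitz gbar D0 k : setting g Dset gbar D0 k ->
  forall (e : R) D D' x, Dset D -> Dset D' -> D0 * e ^+ 2 <= 1 ->
  opnorm12 (D' - D) <= e ->
  (floss g x D' <= floss g x D
     + ((k - 1) * e * (norm2 x * gbar (norm2 x ^+ 2 / 2)))%:E)%E.
Proof.
move=> H e D D' x DD DD' D0e De; set e' := opnorm12 (D' - D) in De.
have e'0 : 0 <= e' := opnorm12_ge0 _; have e0 := le_trans e'0 De.
have x0 := norm2_ge0 x.
have caseI S G : A1 g -> A4 g -> B4 S -> S D -> S D' -> 0 <= G ->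
    (forall D a, S D -> (g a <= (norm2 x ^+ 2 / 2)%:E)%E ->
       norm2 (x - D *m a) <= norm2 x -> norm1 a <= G) ->
    (floss g x D' <= floss g x D + ((2 - 1) * e * (norm2 x * G))%:E)%E.
  move=> g1 g4 Sconv SD SD' G0 aG.
  apply: le_trans (convex_floss_lipschitz g1 g4 Sconv G0 aG SD SD') _.
  rewrite leeD2l // lee_fin -[X in X * e](_ : 1 = 2 - 1); last by lra.
  by rewrite mul1r [leRHS]mulrC ler_wpM2l // mulr_ge0.
case: H => [[g1 _ g3 g4 [-> _ ->]]|[[kappa [[K [gK [gB2 K0]]] Dconv [-> _ ->]]]|]].
- apply: (caseI setT) => //; first exact: gbarA_ge0.
  by move=> D1 a _ ga _; exact: norm1_le_gbarA.
- apply: (caseI Dset) => //.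
  + exact: indicator_A1 gK.
  + exact: indicator_A4 gK K0.
  + exact: gbarB_ge0.
  + by move=> D1 a DD1; exact: norm1_le_gbarB.
move=> [kappa [[K [gK [gB2 K0]]] [-> D0E ->]]]; have [kappa0 _] := gB2.
set G := gbarB _ _; have G0 : 0 <= G by exact: gbarB_ge0.
have G1 a := @norm1_le_gbarB K kappa x D a gK gB2 DD.
have /le_trans := floss_perturb D' (indicator_A1 gK) (indicator_A4 gK K0) G0 G1; apply.
rewrite leeD2l // lee_fin -/e'.
(* As [kappa^-1 <= D0] and [D0 * e ^+ 2 <= 1], the square of [G * e'] is at most [4 * norm2 x ^+ 2].
   Hence the quadratic term [(G * e') ^+ 2 / 2] is at most the linear term [norm2 x * (G * e')], and
   together they give the factor [k - 1 = 2]. *)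
have Ge' : G * e' <= 2 * norm2 x.
  rewrite -ler_sqr ?nnegrE ?mulr_ge0 // exprMn gbarB_half_sqr // -mulrA.
  apply: ler_piMr; first exact: sqr_ge0.
  apply: le_trans D0e; apply: (@le_trans _ _ (D0 * e' ^+ 2)).
    by rewrite ler_wpM2r ?sqr_ge0 // D0E le_max lexx.
  by rewrite ler_wpM2l ?ler_sqr ?nnegrE // D0E le_max ler01 orbT.
have Gsqr : G * e' * (G * e') <= 2 * norm2 x * (G * e').
  by rewrite ler_wpM2r // mulr_ge0.
have : norm2 x * G * e' <= norm2 x * G * e by rewrite ler_wpM2l // mulr_ge0.
lra.
Qed.

End Setting.

(** * Measurability of the norm and of the loss in the sample point *)

Section Measurability.
Context {R : realType}.

Lemma open_measurable_Rvec m (A : set 'cV[R]_m) :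
  open A -> measurable (A : set (Rvec R m)).
Proof. exact: sub_gen_smallest. Qed.

Lemma continuous_norm2B m (v : 'cV[R]_m) : continuous (fun x : 'cV[R]_m => norm2 (x - v)).
Proof.
move=> x; apply: (@continuous_comp _ _ _
  (fun x : 'cV[R]_m => \sum_i (x - v) i 0 ^+ 2) Num.sqrt); last exact: sqrt_continuous.
apply: (continuous_big (op := +%R)) => [|i _ y]; first exact: add_continuous.
rewrite (_ : (fun _ => _) = (fun x : 'cV[R]_m => (x i 0 - v i 0) ^+ 2)); last first.
  by apply/funext => z; rewrite !mxE.
apply: (@continuous_comp _ _ _ (fun x : 'cV[R]_m => x i 0 - v i 0)
  (fun r : R => r ^+ 2)); last exact: exprn_continuous.
by apply: continuousB; [exact: coord_continuous|exact: cst_continuous].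
Qed.

Lemma measurable_norm2 m : measurable_fun setT (@norm2 R m : Rvec R m -> R).
Proof.
apply: (measurability _ (RGenOInfty.measurableE R)) => _ [_ [y ->] <-].
rewrite setTI; apply: open_measurable_Rvec.
rewrite (_ : @norm2 R m = fun x : 'cV[R]_m => norm2 (x - 0)); last first.
  by apply/funext => x; rewrite subr0.
by apply: open_comp; [move=> x _; exact: continuous_norm2B|exact: interval_open].
Qed.

Variables (m d : nat) (g : 'cV[R]_d -> \bar R).

(** The infimum runs over uncountably many [a], but the strict sublevel sets of each [Lx g x D a]
    are open in [x], and any union of open sets is open. *)
Lemma open_floss_lt (D : 'M[R]_(m, d)) (y : \bar R) :
  A1 g -> open [set x | (floss g x D < y)%E].
Proof.
move=> g1; rewrite (_ : [set _ | _] = \bigcup_a [set x | (Lx g x D a < y)%E]).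
  apply: bigcup_open => a _; rewrite /Lx.
  have := g1 a; case: (g a) => [r _|_|] //; last first.
    rewrite (_ : [set _ | _] = set0); first exact: open0.
    by rewrite -subset0 => x /=; rewrite addey // ltNge leey.
  have Lcont : continuous (fun x : 'cV[R]_m => 2^-1 * norm2 (x - D *m a) ^+ 2 + r).
    move=> x; apply: (@continuousD _ _ _
      (fun x : 'cV[R]_m => 2^-1 * norm2 (x - D *m a) ^+ 2) (cst r));
      last exact: cst_continuous.
    apply: (@continuous_comp _ _ _ (fun x : 'cV[R]_m => norm2 (x - D *m a) ^+ 2)
      ( *%R 2^-1)); last exact: mulrl_continuous.
    apply: (@continuous_comp _ _ _ (fun x : 'cV[R]_m => norm2 (x - D *m a))
      (fun r : R => r ^+ 2)); last exact: exprn_continuous.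
    exact: continuous_norm2B.
  case: y => [y| |].
  - rewrite (_ : [set _ | _] =
        (fun x => 2^-1 * norm2 (x - D *m a) ^+ 2 + r) @^-1` `]-oo, y[).
      by apply: open_comp; [move=> x _; exact: Lcont|exact: interval_open].
    by apply/seteqP; split => x /=; rewrite in_itv /= -EFinD lte_fin.
  - rewrite (_ : [set _ | _] = setT); first exact: openT.
    by apply/seteqP; split => x //= _; rewrite -EFinD ltry.
  - rewrite (_ : [set _ | _] = set0); first exact: open0.
    by rewrite -subset0 => x /=; rewrite ltNge leNye.
apply/seteqP; split => [x /ereal_inf_ltP [_ [a _ <-]]|x [a _ /=]] Ly.
  by exists a.
by apply: le_lt_trans Ly; apply: ge_ereal_inf; exists (Lx g x D a) => //; exists a.
Qed.

Lemma measurable_floss (D : 'M[R]_(m, d)) : A1 g ->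
  measurable_fun setT (fun x : Rvec R m => floss g x D).
Proof.
move=> g1; apply: (measurability _ (ErealGenCInfty.measurableE R)).
move=> _ [_ [y ->] <-]; rewrite setTI preimage_itvcy.
rewrite (_ : [set _ | _] = ~` [set x | (floss g x D < y%:E)%E]).
  by apply: measurableC; exact: open_measurable_Rvec (open_floss_lt g1).
by apply/seteqP; split => x /=; rewrite leNgt => /negP.
Qed.

End Measurability.

(** * From the pointwise Lipschitz bound to [Ef] and [Femp] *)

Section Expectation.
Context {R : realType} {m d : nat}.
Variables (g : 'cV[R]_d -> \bar R) (gbar : R -> R).
Hypotheses (g1 : A1 g) (gbar_ge0 : forall t, 0 <= gbar t).
Hypothesis gbar_mono : {homo gbar : s t / s <= t}.

(** Lipschitz constant of the loss at [x] up to the factor [k - 1]. Its empirical mean is [LX] and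
    its expectation is [LP]. *)
Let lip (x : 'cV[R]_m) := norm2 x * gbar (norm2 x ^+ 2 / 2).

Lemma lip_ge0 x : 0 <= lip x.
Proof. by rewrite mulr_ge0 ?norm2_ge0. Qed.

Lemma measurable_lip : measurable_fun setT (lip : Rvec R m -> R).
Proof.
have mn := @measurable_norm2 R m.
apply: measurable_funM => //; apply: measurableT_comp.
  exact: nondecreasing_measurable.
by apply: measurable_funM => //; exact: measurable_funX.
Qed.

Lemma LP_ge0 (P : probability (Rvec R m) R) : (0 <= LP gbar P)%E.
Proof. by apply: integral_ge0 => x _; rewrite lee_fin lip_ge0. Qed.

Variables (D D' : 'M[R]_(m, d)) (s : R).
Hypothesis s0 : 0 <= s.
Hypothesis lipD : forall x, (floss g x D' <= floss g x D + (s * lip x)%:E)%E.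

(** All integrands are nonnegative, so linearity and monotonicity of the integral hold even where an
    expectation is infinite. *)
Lemma Ef_le (P : probability (Rvec R m) R) :
  (Ef g P D' <= Ef g P D + s%:E * LP gbar P)%E.
Proof.
have ml : measurable_fun setT (fun x : Rvec R m => (lip x)%:E).
  by apply/measurable_EFinP; exact: measurable_lip.
have msl : measurable_fun setT (fun x : Rvec R m => (s%:E * (lip x)%:E)%E).
  exact: measurable_funeM.
have l0 (x : Rvec R m) : setT x -> (0 <= (lip x)%:E)%E.
  by rewrite lee_fin lip_ge0.
have sl0 (x : Rvec R m) : setT x -> (0 <= s%:E * (lip x)%:E)%E.
  by move=> xT; rewrite mule_ge0 // l0.
rewrite /Ef /LP -(ge0_integralZl_EFin _ measurableT l0 ml s0).
have f0 (D0 : 'M[R]_(m, d)) (x : Rvec R m) : setT x -> (0 <= floss g x D0)%E.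
  by move=> _; exact: floss_ge0.
have mf (D0 : 'M[R]_(m, d)) := measurable_floss D0 g1.
rewrite -(ge0_integralD _ measurableT (f0 D) (mf D) sl0 msl).
apply: (ge0_le_integral _ measurableT (f0 D') (mf D')); first exact: emeasurable_funD.
by move=> x _; rewrite -EFinM; exact: lipD.
Qed.

Lemma Femp_le n (X : 'I_n -> 'cV[R]_m) :
  (Femp g X D' <= Femp g X D + (s * LX gbar X)%:E)%E.
Proof.
have -> : (s * LX gbar X)%:E = ((n%:R)^-1%:E * \sum_(i < n) (s * lip (X i))%:E)%E.
  by rewrite sumEFin -EFinM -mulr_sumr mulrCA.
rewrite /Femp -ge0_muleDr; last 2 first.
- by apply: sume_ge0 => i _; exact: floss_ge0.
- by apply: sume_ge0 => i _; rewrite lee_fin mulr_ge0 // lip_ge0.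
rewrite lee_wpmul2l ?lee_fin // -big_split /=.
by apply: lee_sum => i _; exact: lipD.
Qed.

End Expectation.

(** * Numerical estimates on the sample size and the net *)

Section Numerics.
Context {R : realType}.

(* [x / 0 = 0] rules out [n = 1]; the other small sample sizes contradict
   [8 ln n <= n]. *)
Lemma ln_ge2 (n : nat) : 8 <= n%:R / ln (n%:R : R) -> 2 <= ln (n%:R : R).
Proof.
case: n => [|[|n]]; first by rewrite mul0r lern0.
  by rewrite ln1 invr0 mulr0 lern0.
set N : R := n.+2%:R => HN.
have N2 : 2 <= N by rewrite ler_nat.
have N0 : 0 < N by lra.
have L0 : 0 < ln N by rewrite ln_gt0 //; lra.
move: HN; rewrite ler_pdivlMr // => HN.
rewrite leNgt; apply/negP => L2.
(* Here [y] is the square root of [N], and [u = y ^ (-1/6)]. If [ln N < 2], then [expR t >= 1 + t]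
   gives [u > 5/6], so [y < (6/5) ^ 6 < 3]. *)
set u := expR (- (ln N / 12)); set y := expR (ln N / 2).
have uL : 5 / 6 < u by have := expR_ge1Dx (- (ln N / 12)); rewrite -/u; lra.
have yu : y * u ^+ 6 = 1.
  rewrite /y /u -expRM_natl -expRD -[RHS]expR0; congr expR.
  by rewrite -mulr_natl; field.
have y0 : 0 < y := expR_gt0 _.
have yy : y ^+ 2 = N.
  by rewrite -expRM_natl -[RHS](lnK (x := N)) ?posrE //; congr expR; rewrite -mulr_natl; field.
have y3 : y < 3.
  rewrite ltNge; apply/negP => y3.
  have u6 : (5 / 6) ^+ 6 <= u ^+ 6 by rewrite lerXn2r ?nnegrE //; lra.
  have : 3 * (5 / 6) ^+ 6 <= y * u ^+ 6 by rewrite ler_pM //; lra.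
  by rewrite yu; lra.
have Ly : y * (1 - ln N / 2) <= 1.
  have /(ler_wpM2l (ltW y0)) := expR_ge1Dx (- (ln N / 2)).
  by rewrite -[in X in _ <= X]expRD subrr expR0.
(* Now [16 * (y - 1) <= 8 * y * ln N <= y ^+ 3]. This fails on [[7/5, 3]], where the chord of the
   square between the endpoints bounds [y ^+ 2]. *)
have y14 : 7 / 5 <= y by rewrite leNgt; apply/negP => y14; nra.
have y_sqr : y ^+ 2 <= 22 / 5 * y - 21 / 5 by nra.
have y_cube : y * y ^+ 2 <= y * (22 / 5 * y - 21 / 5) by rewrite ler_wpM2l // ltW.
have : 8 * (y * ln N) <= y * y ^+ 2 by rewrite mulrCA yy ler_wpM2l ?(ltW y0) // mulrC.
nra.
Qed.

Lemma sqrtr_subadd (a b : R) : 0 <= a -> 0 <= b ->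
  Num.sqrt (a + b) <= Num.sqrt a + Num.sqrt b.
Proof.
move=> a0 b0; rewrite -ler_sqr ?nnegrE ?addr_ge0 ?sqrtr_ge0 // sqrrD.
rewrite !sqr_sqrtr ?addr_ge0 // addrAC lerDl mulrn_wge0 // mulr_ge0 ?sqrtr_ge0
  //.
Qed.

(** In logarithms: [beta * ln N > 1] gives [- ln q < ln N / 2] for the root [q] in [eps], so [h * ln
    (C / eps) < beta + beta * ln N / 2], which is at most [beta * ln N] because [ln N >= 2].
    Strictness lets a cover be extracted from the infimum defining the covering number. *)
Lemma cover_size_bound (C c L h N : R) : 1 <= C -> 0 < c -> 0 < L -> 1 <= h ->
  0 < N -> 2 <= ln N ->
  let beta := h * Num.max (ln (2 * L * C / c)) 1 in
  let eps := c / (2 * L) * Num.sqrt (beta * ln N / N) in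
  0 < eps /\ (C / eps) `^ h < expR (beta * ln N).
Proof.
move=> C1 c0 L0 h1 N0 lnN2 beta eps.
pose M := Num.max (ln (2 * L * C / c)) 1; have betaE : beta = h * M by [].
have M1 : 1 <= M by rewrite le_max lexx orbT.
have logM : ln (2 * L * C / c) <= M by rewrite le_max lexx.
have h0 : 0 < h by lra.
have hb : h <= beta by rewrite betaE ler_peMr // ltW.
have b1 : 1 <= beta := le_trans h1 hb.
have beta0 : 0 < beta by lra.
have lnN0 : 0 < ln N by lra.
have q0 : 0 < beta * ln N / N by rewrite divr_gt0 // mulr_gt0.
pose q := Num.sqrt (beta * ln N / N); have sq0 : 0 < q by rewrite sqrtr_gt0.
have cL0 : 0 < c / (2 * L) by rewrite divr_gt0 // mulr_gt0.
have eps0 : 0 < eps by rewrite mulr_gt0.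
split=> //; have C0 : 0 < C by lra.
have Ceps : 0 < C / eps by rewrite divr_gt0.
rewrite -[C / eps](lnK (x := C / eps)) ?posrE // -expRM mulrC ltr_expR.
have -> : C / eps = (2 * L * C / c) / q.
  by rewrite /eps -/q; field; rewrite ?lt0r_neq0.
have A0 : 0 < 2 * L * C / c by rewrite divr_gt0 ?mulr_gt0.
rewrite ln_div ?posrE //.
have lnq : ln q *+ 2 = ln beta + ln (ln N) - ln N.
  have blnN0 : 0 < beta * ln N by rewrite mulr_gt0.
  have <- : ln (beta * ln N) = ln beta + ln (ln N) := lnM beta0 lnN0.
  have <- : ln (beta * ln N / N) = ln (beta * ln N) - ln N := ln_div blnN0 N0.
  by rewrite -lnXn // sqr_sqrtr // ltW.
have lb : 0 <= ln beta by rewrite ln_ge0.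
have ll : 0 < ln (ln N) by rewrite ln_gt0 //; lra.
have : h * (ln (2 * L * C / c) - ln q) < h * (M + ln N / 2).
  rewrite ltr_pM2l //; rewrite mulr2n in lnq; lra.
move/lt_le_trans; apply; rewrite mulrDr -betaE.
have : h * (ln N / 2) <= beta * (ln N / 2) by rewrite ler_wpM2r //; lra.
have : beta * 2 <= beta * ln N by rewrite ler_wpM2l //; lra.
lra.
Qed.

(** The first inequality forces [F'] and [E'] to be finite, and the comparisons then force [F] and
    [E] to be finite. What remains is the triangle inequality for reals. *)
Lemma abs_sub_perturb (F F' E E' : \bar R) (a b : R) :
  (`|F' - E'| <= a%:E)%E -> (F <= F' + b%:E)%E -> (F' <= F + b%:E)%E ->
  (E <= E' + b%:E)%E -> (E' <= E + b%:E)%E -> (`|F - E| <= (a + 2 * b)%:E)%E.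
Proof.
case: F' => [f'| |]; case: E' => [e'| |] //; case: F => [f| |]; case: E => [e| |] //.
rewrite -!EFinD !lee_fin => H1 H2 H3 H4 H5.
by move: H1; rewrite !ler_norml => /andP[? ?]; apply/andP; split; lra.
Qed.

End Numerics.

(** * Union bound over a finite net *)

Lemma measure_bigsetU_le d (T : measurableType d) (R : realType)
    (mu : {measure set T -> \bar R}) (I : eqType) (Q : seq I) (E : I -> set T) (b : R) :
  (forall i, measurable (E i)) -> (forall i, i \in Q -> (mu (E i) <= b%:E)%E) ->
  (mu (\big[setU/set0]_(i <- Q) E i) <= ((size Q)%:R * b)%:E)%E.
Proof.
move=> mE; elim: Q => [|i Q IH] EQ; first by rewrite big_nil measure0 mul0r.
have mU : measurable (\big[setU/set0]_(j <- Q) E j) by exact: bigsetU_measurable.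
rewrite big_cons; apply: (le_trans (measureU2 mu (mE i) mU)).
rewrite -natr1 mulrDl mul1r addrC EFinD leeD ?EQ ?mem_head // IH // => j jQ.
by rewrite EQ // in_cons jQ orbT.
Qed.

Lemma eps_cover_of_covering_number (R : realType) m d (Dset : set 'M[R]_(m, d))
    (eps y : R) : (covering_number Dset eps < y%:E)%E ->
  exists2 Q, is_eps_cover Dset eps Q & (size Q)%:R <= y.
Proof.
by move=> /ereal_inf_ltP[_ [Q [_ QD] <-]]; rewrite lte_fin => /ltW; exists Q.
Qed.

(** * Measurability of the exceptional events *)

Section Sample.
Context {R : realType} {m d n : nat} {dO : measure_display}.
Context {Omega : measurableType dO}.
Variables (xs : 'I_n -> Omega -> Rvec R m).
Hypothesis mxs : forall i, measurable_fun setT (xs i).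

Lemma measurable_Femp_dev (g : 'cV[R]_d -> \bar R) D (e : \bar R) (r : R) : A1 g ->
  measurable [set w | (r%:E < `| Femp g (fun i => xs i w) D - e |)%E].
Proof.
move=> g1; rewrite -[X in measurable X]setTI.
apply: emeasurable_fun_o_infty => //; apply: measurableT_comp => //.
apply: emeasurable_funB => //; apply: measurable_funeM.
apply: emeasurable_sum => i.
exact: measurableT_comp (measurable_floss D g1) (mxs i).
Qed.

Lemma measurable_LX_gt (gbar : R -> R) (L : R) : {homo gbar : s t / s <= t} ->
  measurable [set w | L < LX gbar (fun i => xs i w)].
Proof.
move=> gbar_mono.
rewrite (_ : [set _ | _] =
  setT `&` [set w | (L%:E < (LX gbar (fun i => xs i w))%:E)%E]); last first.
  by apply/seteqP; split => w /=; rewrite lte_fin; tauto.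
apply: emeasurable_fun_o_infty => //; apply/measurable_EFinP.
apply: measurable_funM => //; apply: measurable_sum => i.
exact: measurableT_comp (measurable_lip gbar_mono) (mxs i).
Qed.

End Sample.

(** Facts common to all settings: [1 <= D0] keeps the net radius at most 1, and [1 <= k] makes the
    Lipschitz factor [k - 1] nonnegative. *)
Lemma settingP (R : realType) m d (g : 'cV[R]_d -> \bar R) (Dset : set 'M[R]_(m, d))
    gbar D0 k : setting g Dset gbar D0 k ->
  [/\ A1 g, forall t, 0 <= gbar t, {homo gbar : s t / s <= t} & 1 <= D0 /\ 1 <= k].
Proof.
case=> [[g1 _ g3 _ [-> -> ->]]|[[kappa [[K [gK [[kappa0 _] _]]] _ [-> -> ->]]]|]].
- split => [//|t||]; [exact: gbarA_ge0|exact: gbarA_nondecreasing|split; lra].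
- split; [exact: indicator_A1 gK|exact: gbarB_ge0|exact: gbarB_nondecreasing|split; lra].
move=> [kappa [[K [gK [[kappa0 _] _]]] [-> -> ->]]].
split; [exact: indicator_A1 gK|exact: gbarB_ge0|exact: gbarB_nondecreasing|split; last lra].
by rewrite le_max lexx orbT.
Qed.

(** * The uniform deviation bound *)

Theorem theorem1 (R : realType) (m d n : nat)
  (g : 'cV[R]_d -> \bar R) (Dset : set 'M[R]_(m, d))
  (gbar : R -> R) (D0 k : R)
  (P : probability (Rvec R m) R) (c : R) (T : \bar R) (C h L : R)
  (dO : measure_display) (Omega : measurableType dO) (Pr : probability Omega R)
  (xs : 'I_n -> Omega -> Rvec R m) :
  (0 < m)%N -> (0 < d)%N -> (0 < n)%N ->
  is_penalty g ->
  setting g Dset gbar D0 k ->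
  C1 gbar P ->
  C2 g Dset P c T ->
  1 <= C -> 1 <= h ->
  (forall eps : R, 0 < eps <= 1 ->
     (covering_number Dset eps <= ((C / eps) `^ h)%:E)%E) ->
  (LP gbar P < L%:E)%E ->
  let beta := h * Num.max (ln (2 * L * C / c)) 1 in
  Num.max 8 (Num.max (beta_over_T2 beta T) (D0 * (c / (2 * L)) ^+ 2 * beta))
    <= n%:R / ln n%:R ->
  iid_sample Pr P xs ->
  forall x : R, 0 <= x ->
  (x%:E <= (n%:R)%:E * T * T - (beta * ln n%:R)%:E)%E ->
  let eta := k * c * Num.sqrt (beta * ln n%:R / n%:R) + c * Num.sqrt ((beta + x) / n%:R) in
  exists A : set Omega, [/\ measurable A,
    (Pr A <= Lambda Pr gbar xs L + (2 * expR (- x))%:E)%E &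
    forall w, ~ A w -> forall D, Dset D ->
      (`| Femp g (fun i => xs i w) D - Ef g P D | <= eta%:E)%E].
Proof.
move=> _ _ n0 _ gset _ [c0 T0 PC2] C1 h1 cov LPL beta nbig xsiid x x0 xT eta.
have [mxs _ _] := xsiid.
have [g1 gbar0 gbar_mono [D0_ge1 k1]] := settingP gset.
have L0 : 0 < L by rewrite -lte_fin; apply: le_lt_trans (LP_ge0 gbar0 P) LPL.
pose N : R := n%:R; have N0 : 0 < N by rewrite ltr0n.
move: nbig; rewrite !ge_max => /and3P[/ln_ge2 lnN2 _ nD0].
have [] := cover_size_bound C1 c0 L0 h1 N0 lnN2; rewrite -/beta -/N.
set S := Num.sqrt (beta * ln N / N); set eps := c / (2 * L) * S => eps0 Ceps.
have b1 : 1 <= beta.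
  apply: (le_trans h1); apply: ler_peMr; first lra.
  by rewrite le_max lexx orbT.
have lnN0 : 0 < ln N by lra.
have q0 : 0 <= beta * ln N / N by apply: divr_ge0; [apply: mulr_ge0|]; lra.
(* This is the last of the lower bounds on [n / ln n], rearranged. It yields both the Lipschitz
   bound at scale [eps] and [eps <= 1], the range of the covering hypothesis. *)
have D0eps : D0 * eps ^+ 2 <= 1.
  rewrite exprMn sqr_sqrtr //.
  have -> : D0 * ((c / (2 * L)) ^+ 2 * (beta * ln N / N)) =
      D0 * (c / (2 * L)) ^+ 2 * beta * (ln N / N) by ring.
  by rewrite -[ln N / N]invf_div -ler_pdivlMr ?invr_gt0 ?divr_gt0 // invrK mul1r.
have eps1 : eps <= 1.
  rewrite -[_ <= _](ler_pXn2r (n := 2)) ?nnegrE ?(ltW eps0) // expr1n.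
  by apply: le_trans D0eps; rewrite ler_peMl ?sqr_ge0.
have [Q [QD Qcov] Qsize] : exists2 Q, is_eps_cover Dset eps Q &
    (size Q)%:R <= expR (beta * ln N).
  apply: eps_cover_of_covering_number; apply: le_lt_trans (cov eps _) _.
    by rewrite eps0.
  by rewrite lte_fin.
pose tau := Num.sqrt ((beta * ln N + x) / N).
have bx0 : 0 <= (beta * ln N + x) / N.
  by apply: divr_ge0; [apply: addr_ge0; [apply: mulr_ge0|]|]; lra.
have tau0 : 0 <= tau := sqrtr_ge0 _.
have tau_sqr : tau ^+ 2 = (beta * ln N + x) / N by rewrite /tau sqr_sqrtr.
(* Since [N * tau ^+ 2 = beta * ln N + x], for finite [T] this is the assumed upper bound on [x]. *)
have tauT : (tau%:E <= T)%E.
  case: T T0 xT {PC2} => [t| |] // t0 xT; last by rewrite leey.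
  rewrite lte_fin in t0; rewrite -!EFinM -EFinB lee_fin -/N in xT.
  rewrite lee_fin -(ler_pXn2r (n := 2)) ?nnegrE ?(ltW t0) // tau_sqr.
  by rewrite ler_pdivrMr //; lra.
pose F w D := Femp g (fun i => xs i w) D.
pose E q := [set w | ((c * tau)%:E < `|F w q - Ef g P q|)%E].
pose B := [set w | L < LX gbar (fun i => xs i w)].
exists (B `|` \big[setU/set0]_(q <- Q) E q).
have mE q : measurable (E q) by exact: measurable_Femp_dev.
have mB : measurable B by exact: measurable_LX_gt.
have mEs : measurable (\big[setU/set0]_(q <- Q) E q) by exact: bigsetU_measurable.
split; first exact: measurableU.
- apply: le_trans (measureU2 _ mB mEs) _; rewrite leeD2l //.
  have PrE q : q \in Q -> (Pr (E q) <= (2 * expR (- (beta * ln N + x)))%:E)%E.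
    move=> qQ; have := PC2 _ _ _ _ _ n0 xsiid tau tau0 tauT.
    rewrite tau_sqr mulrCA divff ?lt0r_neq0 // mulr1; apply: le_trans.
    by apply: ereal_sup_ubound; exists q => //; exact: QD.
  (* The size of the net, at most [expR (beta * ln N)], cancels the same factor in each deviation
     probability and leaves [2 * expR (- x)]. *)
  apply: le_trans (measure_bigsetU_le mE PrE) _; rewrite lee_fin.
  apply: le_trans (ler_wpM2r _ Qsize) _; first by rewrite mulr_ge0 ?expR_ge0.
  by rewrite mulrCA -expRD opprD addrA subrr add0r.
move=> w wA D DD.
have LXL : LX gbar (fun i => xs i w) <= L.
  by rewrite leNgt; apply/negP => LX; apply: wA; left.
have [q qQ Dq] := Qcov D DD.
have Dq' : opnorm12 (q - D) <= eps by rewrite -opprB opnorm12N.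
have s0 : 0 <= (k - 1) * eps by rewrite mulr_ge0 ?(ltW eps0) // subr_ge0.
(* The one-sided bound is taken in both directions between [q] and [D] to control an absolute
   value. *)
have lipq y := setting_floss_lipschitz gset y (QD q qQ) DD D0eps Dq.
have lipD y := setting_floss_lipschitz gset y DD (QD q qQ) D0eps Dq'.
have Fle (u v : \bar R) : (u <= v + ((k - 1) * eps * LX gbar (fun i => xs i w))%:E)%E ->
    (u <= v + ((k - 1) * eps * L)%:E)%E.
  by move/le_trans; apply; rewrite leeD2l // lee_fin ler_wpM2l.
have Ele (u v : \bar R) : (u <= v + ((k - 1) * eps)%:E * LP gbar P)%E ->
    (u <= v + ((k - 1) * eps * L)%:E)%E.
  by move/le_trans; apply; rewrite leeD2l // [leRHS]EFinM lee_wpmul2l ?lee_fin // ltW.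
have qdev : (`|F w q - Ef g P q| <= (c * tau)%:E)%E.
  rewrite leNgt; apply/negP => Eq; apply: wA; right.
  by rewrite -bigcup_seq; exists q.
have := abs_sub_perturb qdev (Fle _ _ (Femp_le g1 gbar0 s0 lipq _))
  (Fle _ _ (Femp_le g1 gbar0 s0 lipD _)) (Ele _ _ (Ef_le g1 gbar0 gbar_mono s0 lipq P))
  (Ele _ _ (Ef_le g1 gbar0 gbar_mono s0 lipD P)).
move/le_trans; apply; rewrite lee_fin /eta -/N -/S.
(* The choice of [eps] makes the two Lipschitz errors, for [Femp] and [Ef], add up to
   [(k - 1) * c * S]. Splitting the root in [tau] contributes one more [c * S], hence the constant
   [k] in [eta]. *)
have epsL : 2 * (eps * L) = c * S by rewrite /eps; field; rewrite lt0r_neq0.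
have tauS : tau <= S + Num.sqrt ((beta + x) / N).
  rewrite /tau mulrDl; apply: le_trans (sqrtr_subadd q0 _) _.
    by rewrite divr_ge0 // ltW.
  by rewrite lerD2l ler_wsqrtr // ler_pM2r ?invr_gt0 //; lra.
have : c * tau <= c * (S + Num.sqrt ((beta + x) / N)) by rewrite ler_pM2l.
have -> : 2 * ((k - 1) * eps * L) = (k - 1) * (c * S) by rewrite -epsL; ring.
lra.
Qed.
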